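(* There exists a homeomorphism $f:\overline{\mathbb{D}}\rightarrow\overline{\mathbb{D}}$ of the unit closed disk $\overline{\mathbb{D}}=\{z\in\mathbb{C} : |z|\leq 1\}$ onto itself such that $f$ is Li-Yorke chaotic but its inverse $f^{-1}$ is not Li-Yorke chaotic.
   Context: The disk $\overline{\mathbb{D}}$ carries the usual metric $d(z,w)=|z-w|$. Let $X$ be a compact metric space with metric $d$ and let $f:X\rightarrow X$ be a continuous map; $f^{n}$ denotes the $n$-th iterate of $f$. A pair $\{x,y\}\subseteq X$ is called a Li-Yorke chaotic pair (for $f$) if $$\limsup_{n\rightarrow+\infty}d(f^{n}(x),f^{n}(y))>0 \quad\text{and}\quad \liminf_{n\rightarrow+\infty}d(f^{n}(x),f^{n}(y))=0.$$ The map $f$ is called Li-Yorke chaotic if there exists an uncountable subset $\Gamma\subseteq X$ such that each pair of two distinct points in $\Gamma$ is a Li-Yorke chaotic pair for $f$. *)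

(* Defs.v *)
From HB Require Import structures.
From mathcomp Require Import all_boot all_order all_algebra complex.
From mathcomp Require Import all_classical all_reals all_analysis.

Set Implicit Arguments.
Unset Strict Implicit.
Unset Printing Implicit Defensive.

Import Order.TTheory GRing.Theory Num.Theory.

Local Open Scope classical_set_scope.
Local Open Scope ring_scope.
Local Open Scope complex_scope.

Section ClosedDisk.
Context (R : realType).

Definition disk : Type := {z : R[i] | `|z| <= 1}.

HB.instance Definition _ := SubChoice.on disk.

(* The norm of [R[i]] is [R[i]]-valued, with zero imaginary part. *)
Definition disk_dist (z w : disk) : R := complex.Re `|\val z - \val w|.

Lemma disk_distE (z w : disk) : (disk_dist z w)%:C = `|\val z - \val w|.
Proof. by rewrite /disk_dist RRe_real ?normr_real. Qed.

Lemma disk_distxx z : disk_dist z z = 0.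
Proof. by apply/complexI; rewrite disk_distE subrr normr0. Qed.

Lemma disk_dist_eq0 z w : disk_dist z w = 0 -> z = w.
Proof.
move=> zw; apply/val_inj/eqP; rewrite -subr_eq0 -normr_eq0 -disk_distE.
by rewrite zw.
Qed.

Lemma disk_distC z w : disk_dist z w = disk_dist w z.
Proof. by rewrite /disk_dist distrC. Qed.

Lemma disk_dist_triangle v z w :
  disk_dist z w <= disk_dist z v + disk_dist v w.
Proof. by rewrite -lecR rmorphD /= !disk_distE ler_distD. Qed.

HB.instance Definition _ := isMetric.Build R disk
  disk_distxx disk_dist_eq0 disk_distC disk_dist_triangle.

End ClosedDisk.

Section LiYorke.
Context (R : realType) (X : metricType R).
Implicit Types (f : X -> X) (x y : X).

Definition orbit_dist f x y (n : nat) : \bar R :=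
  (mdist (iter n f x) (iter n f y))%:E.

Definition li_yorke_pair f x y : Prop :=
  (0 < limn_esup (orbit_dist f x y))%E /\ limn_einf (orbit_dist f x y) = 0%E.

Definition li_yorke_chaotic f : Prop :=
  exists G : set X, ~ countable G /\
    forall x y, G x -> G y -> x <> y -> li_yorke_pair f x y.

End LiYorke.

(* Main.v *)
(* The homeomorphism is the time-one map of a flow on the disk that fixes [0] and
   the boundary circle and moves every other point from [0] towards the circle,
   [logit |z|] increasing at unit speed.  At integer times the flow extends
   continuously by the identity on the circle, since the rotation around [0] slows
   down near the circle; but the angular position [phase t] oscillates forever,
   with an amplitude that depends on the fractional part of [t] and returns to [0]
   infinitely often.  The points [disk_flow t base_point], [0 <= t <= 1/2], thus
   separate and approach each other infinitely often in the future.  In the past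
   every interior orbit tends to [0] while the circle is fixed, so the inverse has
   no Li-Yorke pair at all. *)

Require Import Defs.
From mathcomp Require Import all_boot all_order all_algebra.
From mathcomp Require Import all_classical all_reals all_analysis.
From mathcomp Require Import complex ring lra zify.

Set Implicit Arguments.
Unset Strict Implicit.
Unset Printing Implicit Defensive.

Import Order.TTheory GRing.Theory Num.Theory.
Import numFieldNormedType.Exports ComplexField Normc.

Local Open Scope classical_set_scope.
Local Open Scope ring_scope.
Local Open Scope complex_scope.

(** * The oscillating angular profile on the real line *)

Section Phase.
Context {R : realType}.
Implicit Types (t x y : R).

(** The distance from [x] to the nearest integer, a [1]-periodic sawtooth. *)
Definition tri x : R :=
  Num.min (x - (Num.floor x)%:~R) ((Num.floor x)%:~R + 1 - x).

Lemma tri_ge0 x : 0 <= tri x.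
Proof.
have /andP[] := floor_itv x; rewrite intrD /tri le_min => *.
by apply/andP; split; lra.
Qed.

Lemma tri_le_half x : tri x <= 1 / 2.
Proof. by rewrite /tri ge_min; case: lerP => //= ?; lra. Qed.

Lemma tri_le_dist x (m : int) : tri x <= `|x - m%:~R|.
Proof.
have /andP[fx xf] := floor_itv x; rewrite intrD in xf.
rewrite /tri ge_min; have [mf|fm] := lerP m (Num.floor x).
- have : m%:~R <= (Num.floor x)%:~R :> R by rewrite ler_int.
  by move=> ?; rewrite (le_trans _ (ler_norm _))//; lra.
- have : (Num.floor x + 1)%:~R <= m%:~R :> R by rewrite ler_int lezD1.
  rewrite intrD => ?; rewrite distrC; apply/orP; right.
  by rewrite (le_trans _ (ler_norm _))//; lra.
Qed.

Lemma tri_attained x : exists m : int, tri x = `|x - m%:~R|.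
Proof.
have /andP[fx xf] := floor_itv x; rewrite intrD in xf.
rewrite /tri; case: lerP => _.
- by exists (Num.floor x); rewrite ger0_norm//; lra.
- exists (Num.floor x + 1); rewrite intrD distrC ger0_norm//; lra.
Qed.

Lemma tri_lipschitz x y : `|tri x - tri y| <= `|x - y|.
Proof.
wlog xy : x y / tri y <= tri x.
  move=> H; have /orP[/H//|/H] := le_total (tri y) (tri x).
  by rewrite distrC (distrC y).
rewrite ger0_norm ?subr_ge0//; have [m tym] := tri_attained y.
by rewrite tym lerBlDr (le_trans (tri_le_dist x m))// ler_distD.
Qed.

Lemma triDz x (m : int) : tri (x + m%:~R) = tri x.
Proof.
rewrite /tri floorDrz ?intr_int// intrKfloor intrD.
by congr Num.min; ring.
Qed.

Lemma tri_id x : 0 <= x <= 1 / 2 -> tri x = x.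
Proof.
move=> /andP[x0 x1]; have x_floor : Num.floor x = 0.
  by apply: floor_def; rewrite x0 /=; lra.
by rewrite /tri x_floor subr0 add0r; apply/min_idPl; lra.
Qed.

(** Oscillates forever between [0], at squares of even numbers, and [1/2], at squares of odd ones,
    but ever more slowly because of the square root: its variation over a unit of time tends to
    [0]. *)
Definition slow t : R := tri (Num.sqrt `|t| / 2).

Lemma slow_ge0 t : 0 <= slow t. Proof. exact: tri_ge0. Qed.

Lemma slow_le_half t : slow t <= 1 / 2. Proof. exact: tri_le_half. Qed.

Lemma slow_even k : slow ((2 * k) ^ 2)%:R = 0.
Proof.
rewrite /slow ger0_norm ?ler0n// natrX sqrtr_sqr ger0_norm ?ler0n//.
rewrite natrM mulrAC divff ?mul1r ?pnatr_eq0// -[k%:R]add0r.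
by rewrite (triDz 0 (Posz k)) tri_id// lexx/= ; lra.
Qed.

Lemma slow_odd k : slow ((2 * k).+1 ^ 2)%:R = 1 / 2.
Proof.
rewrite /slow ger0_norm ?ler0n// natrX sqrtr_sqr ger0_norm ?ler0n//.
have -> : (2 * k).+1%:R / 2 = 1 / 2 + (Posz k)%:~R :> R.
  by rewrite -natr1 natrM -pmulrn; field.
by rewrite triDz tri_id//; lra.
Qed.

Lemma slow_close x y : 1 <= x -> `|x - y| <= 1 ->
  `|slow x - slow y| <= (Num.sqrt x)^-1.
Proof.
move=> x1 xy; have x0 : 0 < Num.sqrt x by rewrite sqrtr_gt0; lra.
have y0 : 0 <= y by move: xy; rewrite ler_norml; lra.
rewrite /slow (ger0_norm y0) (@ger0_norm _ x); last by lra.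
rewrite (le_trans (tri_lipschitz _ _))// -mulrBl normrM.
rewrite [`|2^-1|]ger0_norm ?invr_ge0// -[leRHS]mul1r ler_pdivlMr//.
(* Factor [x - y] as a difference of squares and drop [sqrt y] from the factor [sqrt x + sqrt y]. *)
have : `|Num.sqrt x - Num.sqrt y| * Num.sqrt x <= 1.
  have xyE : x - y = Num.sqrt x ^+ 2 - Num.sqrt y ^+ 2.
    by rewrite !sqr_sqrtr//; lra.
  rewrite (le_trans _ xy)// xyE subr_sqr normrM ler_wpM2l//.
  rewrite [leRHS]ger0_norm ?addr_ge0 ?sqrtr_ge0//.
  by rewrite lerDl sqrtr_ge0.
lra.
Qed.

(** The factor [tri t] sees only the fractional part of [t], so integer time steps change the phase
    through [slow] alone. *)
Definition phase t : R := tri t * slow t.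

Lemma tri_continuous : continuous tri.
Proof.
move=> x; apply/cvgrPdist_le => e e0.
have : \forall y \near x, `|x - y| <= e.
  exact: (cvgr_dist_le id x (@cvg_id _ (nbhs x))).
by apply: filterS => y; apply: le_trans (tri_lipschitz _ _).
Qed.

Lemma phase_continuous : continuous phase.
Proof.
move=> t; apply: cvgM; first exact: tri_continuous.
apply: (@continuous_comp _ _ _ (fun t => Num.sqrt `|t| / 2) tri); last first.
  exact: tri_continuous.
apply: cvgM; last exact: cvg_cst.
apply: (@continuous_comp _ _ _ (fun t => `|t|) Num.sqrt); last first.
  exact: sqrt_continuous.
exact: norm_continuous.
Qed.

Lemma phase_norm_le1 t : `|phase t| <= 1.
Proof.
rewrite normrM !ger0_norm ?tri_ge0 ?slow_ge0//.
by have := (tri_ge0 t, tri_le_half t, slow_ge0 t, slow_le_half t) => -[[[]]]; nra.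
Qed.

Lemma phase_shift t (m : int) : 1 <= t -> `|m%:~R| <= 1 :> R ->
  `|phase (t + m%:~R) - phase t| <= (Num.sqrt t)^-1.
Proof.
move=> t1 m1; rewrite /phase triDz -mulrBr normrM ger0_norm ?tri_ge0// distrC.
have := @slow_close t (t + m%:~R) t1; rewrite opprD addNKr normrN => /(_ m1).
have := (tri_ge0 t, tri_le_half t, normr_ge0 (slow t - slow (t + m%:~R))).
by move=> -[[]]; nra.
Qed.

End Phase.

(** * The Cayley transform as a parametrization of the unit circle *)

Section Cayley.
Context {R : realType}.
Implicit Types (a b : R) (z w : R[i]).

Lemma normcR a : normc a%:C = `|a|.
Proof. by rewrite /normc /= expr0n /= addr0 sqrtr_sqr. Qed.

Lemma normc_distC z w : normc (z - w) = normc (w - z).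
Proof. by rewrite -normcN opprB. Qed.

Lemma normc_ge0 z : 0 <= normc z.
Proof. by case: z => a b; rewrite sqrtr_ge0. Qed.

Lemma normc_sub_ge z w : normc z - normc w <= normc (z - w).
Proof. by rewrite lerBlDr (le_trans _ (le_normcD _ _))// subrK. Qed.

(** The point of the unit circle with argument [2 * arctan b], a rational substitute for the complex
    exponential. *)
Definition cayley b : R[i] := (1 +i* b) / (1 -i* b).

Let den_norm b : normc (1 -i* b) = Num.sqrt (1 + b ^+ 2).
Proof. by rewrite /normc expr1n sqrrN. Qed.

Let den_neq0 b : (1 -i* b) != 0 :> R[i].
Proof. by rewrite eq_complex /= oner_eq0. Qed.

Let den_ge1 b : 1 <= normc (1 -i* b).
Proof. by rewrite den_norm -{1}sqrtr1 ler_wsqrtr// lerDl sqr_ge0. Qed.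

Lemma normc_cayley b : normc (cayley b) = 1.
Proof.
have -> : normc (cayley b) = normc (1 -i* b) / normc (1 -i* b).
  by rewrite /cayley normcM normcV den_norm; congr (_ / _); rewrite /normc expr1n.
by rewrite divff// gt_eqF// (lt_le_trans _ (den_ge1 b)).
Qed.

Lemma cayley_neq0 b : cayley b != 0.
Proof.
apply: contra_eq_neq (normc_cayley b) => ->.
by rewrite normc0 eq_sym oner_eq0.
Qed.

(** Comes from [(1 + ia)(1 - ib) - (1 + ib)(1 - ia) = 2i(a - b)]. *)
Lemma normc_cayleyB a b :
  normc (cayley a - cayley b) * (normc (1 -i* a) * normc (1 -i* b)) =
  2 * `|a - b|.
Proof.
have -> : 2 * `|a - b| = normc (0 +i* (2 * (a - b))).
  by rewrite /normc /= expr0n add0r sqrtr_sqr normrM ger0_norm.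
rewrite -!normcM; congr normc; rewrite /cayley mulrBl mulrA divfK//.
rewrite (mulrC (1 -i* a)) [X in _ - X]mulrA divfK//.
by apply/eqP; rewrite eq_complex /=; apply/andP; split; apply/eqP; ring.
Qed.

Lemma normc_cayleyB_le a b : normc (cayley a - cayley b) <= 2 * `|a - b|.
Proof.
rewrite -normc_cayleyB ler_peMr ?normc_ge0//.
by rewrite (le_trans (den_ge1 a))// ler_peMr ?normc_ge0.
Qed.

(** For parameters in [[-1, 1]] each denominator has modulus at most [sqrt 2], so their product is
    absorbed by the factor [2] of [normc_cayleyB]. *)
Lemma normc_cayleyB_ge a b : `|a| <= 1 -> `|b| <= 1 ->
  `|a - b| <= normc (cayley a - cayley b).
Proof.
have den_le (c : R) : `|c| <= 1 -> normc (1 -i* c) <= Num.sqrt 2.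
  move=> c1; rewrite den_norm ler_wsqrtr// -[2]/(1 + 1) lerD2l.
  by rewrite -real_normK ?num_real// expr_le1.
move=> a1 b1; have := normc_cayleyB a b.
have : normc (1 -i* a) * normc (1 -i* b) <= 2.
  by rewrite -[leRHS](@sqr_sqrtr _ 2)// expr2 ler_pM ?normc_ge0 ?den_le.
move=> /(ler_wpM2l (normc_ge0 (cayley a - cayley b))) + ND.
by rewrite ND; lra.
Qed.

End Cayley.

(** * Explicit formulas for the flow and its group law *)

Section Flow.
Context {R : realType}.
Implicit Types (r s t : R) (z w : R[i]).

(** The ratio of the new radius to the old one, in a form that makes sense at [r = 0], so that
    [flow] has no special case at the origin. *)
Definition dilation s r : R := expR s / (1 - r + expR s * r).

(** The time-[s] map of the logistic equation [r' = r (1 - r)]. *)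
Definition push s r : R := dilation s r * r.

(* At [r = 0] and [r = 1] this is the junk value [ln 0 = 0]; it is harmless, since
   [push s] fixes both points and so [twist s] is [1] there. *)
Definition logit r : R := ln (r / (1 - r)).

Definition direction r : R[i] := cayley (phase (logit r)).

(** A coboundary: these quotients telescope under composition, which gives the angular half of the
    group law [flowD]. *)
Definition twist s r : R[i] := direction (push s r) / direction r.

Definition flow s z : R[i] :=
  z * ((dilation s (normc z))%:C * twist s (normc z)).

Lemma dilation_den_gt0 s r : 0 <= r <= 1 -> 0 < 1 - r + expR s * r.
Proof.
move=> /andP[r0 r1]; have := expR_gt0 s; set c := expR s => c0.
by have := mulr_ge0 (ltW c0) r0; have [->|] := eqVneq r 1; nra.
Qed.

Lemma dilation_gt0 s r : 0 <= r <= 1 -> 0 < dilation s r.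
Proof. by move=> r01; rewrite divr_gt0 ?expR_gt0 ?dilation_den_gt0. Qed.

Lemma dilation_le s r : 0 <= r <= 1 -> dilation s r <= expR s + 1.
Proof.
move=> r01; rewrite ler_pdivrMr ?dilation_den_gt0//.
move: r01 => /andP[r0 r1]; have := expR_gt0 s; set c := expR s => c0.
by have := mulr_ge0 (ltW c0) r0; have := mulr_ge0 (ltW c0) (ltW c0); nra.
Qed.

Lemma push_itv s r : 0 <= r <= 1 -> 0 <= push s r <= 1.
Proof.
move=> r01; rewrite /push mulr_ge0//=; last by case/andP: r01.
  by rewrite mulrAC ler_pdivrMr ?dilation_den_gt0//; case/andP: r01; lra.
by rewrite ltW ?dilation_gt0.
Qed.

Lemma onem_push s r : 0 <= r <= 1 ->
  1 - push s r = (1 - r) / (1 - r + expR s * r).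
Proof.
move=> /(dilation_den_gt0 s)/lt0r_neq0 d0; rewrite /push /dilation.
by field.
Qed.

Lemma dilation1 s : dilation s 1 = 1.
Proof. by rewrite /dilation subrr add0r mulr1 divff// gt_eqF ?expR_gt0. Qed.

Lemma push1 s : push s 1 = 1. Proof. by rewrite /push dilation1 mulr1. Qed.

Lemma dilation0 r : dilation 0 r = 1.
Proof. by rewrite /dilation expR0 !mul1r subrK invr1. Qed.

Lemma dilationD s t r : 0 <= r <= 1 ->
  dilation s (push t r) * dilation t r = dilation (s + t) r.
Proof.
move=> r01; have := dilation_den_gt0 (s + t) r01.
have := dilation_den_gt0 t r01; have := dilation_den_gt0 s (push_itv t r01).
rewrite onem_push// /push /dilation expRD => d1 d2 d3.
move: d1; rewrite [X in 0 < _ + X]mulrA [expR s * (_ / _)]mulrA.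
rewrite [X in 0 < _ + X]mulrAC -mulrDl.
rewrite pmulr_lgt0 ?invr_gt0// => d1.
field.
by rewrite !lt0r_neq0.
Qed.

Lemma pushD s t r : 0 <= r <= 1 -> push s (push t r) = push (s + t) r.
Proof. by move=> r01; rewrite {1}/push {2}/push mulrA dilationD. Qed.

(** The odds [r / (1 - r)] get multiplied by [expR s]. *)
Lemma logit_push s r : 0 < r < 1 -> logit (push s r) = logit r + s.
Proof.
move=> /andP[r0 r1]; have r01 : 0 <= r <= 1 by rewrite !ltW.
have /lt0r_neq0 d0 := dilation_den_gt0 s r01.
have r1' : 1 - r != 0 by rewrite subr_eq0 gt_eqF.
rewrite /logit onem_push//.
have -> : push s r / ((1 - r) / (1 - r + expR s * r)) = r / (1 - r) * expR s.
  by rewrite /push /dilation; field; rewrite r1' d0.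
by rewrite lnM ?posrE ?expR_gt0 ?divr_gt0 ?subr_gt0// expRK.
Qed.

Lemma normc_direction r : normc (direction r) = 1.
Proof. exact: normc_cayley. Qed.

Lemma direction_neq0 r : direction r != 0.
Proof. exact: cayley_neq0. Qed.

Lemma normc_twist s r : normc (twist s r) = 1.
Proof. by rewrite /twist normcM normcV !normc_direction invr1 mulr1. Qed.

Lemma twist1 s : twist s 1 = 1.
Proof. by rewrite /twist push1 divff ?direction_neq0. Qed.

Lemma normc_flow s z : normc z <= 1 -> normc (flow s z) = push s (normc z).
Proof.
move=> z1; rewrite /flow normcM normcM normc_twist mulr1 normcR mulrC.
by rewrite ger0_norm// ltW// dilation_gt0// normc_ge0.
Qed.

Lemma flow0 z : flow 0 z = z.
Proof.
by rewrite /flow /twist /push dilation0 mul1r divff ?direction_neq0// !mulr1.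
Qed.

Lemma flowD s t z : normc z <= 1 -> flow s (flow t z) = flow (s + t) z.
Proof.
move=> z1; have z01 : 0 <= normc z <= 1 by rewrite normc_ge0.
rewrite {1}/flow normc_flow// /flow -dilationD// /twist pushD//.
rewrite [(dilation s _ * _)%:C]rmorphM /=.
have := direction_neq0 (push t (normc z)).
have := direction_neq0 (normc z).
set a := direction _; set b := direction _; set c := direction _ => a0 b0.
by field; rewrite a0 b0.
Qed.

Lemma flow1 s z : normc z = 1 -> flow s z = z.
Proof. by move=> z1; rewrite /flow z1 dilation1 twist1 !mulr1. Qed.

End Flow.

(** * Continuity of the radial and angular factors *)

Section Continuity.
Context {R : realType}.
Implicit Types (r s t : R) (z w : R[i]).

Lemma dilation_continuous s r : 0 <= r <= 1 -> {for r, continuous (dilation s)}.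
Proof.
move=> r01; apply: cvgM; first exact: cvg_cst.
apply: cvgV; first by rewrite lt0r_neq0 ?dilation_den_gt0.
apply: cvgD; first by apply: cvgB; [exact: cvg_cst|exact: cvg_id].
by apply: cvgM; [exact: cvg_cst|exact: cvg_id].
Qed.

Lemma logit_continuous r : 0 < r < 1 -> {for r, continuous (@logit R)}.
Proof.
move=> /andP[r0 r1]; apply: continuous_comp; last first.
  by apply: continuous_ln; rewrite divr_gt0 ?subr_gt0.
apply: cvgM; first exact: cvg_id.
apply: cvgV; first by rewrite subr_eq0 gt_eqF.
by apply: cvgB; [exact: cvg_cst|exact: cvg_id].
Qed.

(** A quotient of unimodular numbers is [1]-Lipschitz in each argument, and [cayley] is
    [2]-Lipschitz. *)
Lemma normc_twistB s r t :
  normc (twist s r - twist s t) <=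
  2 * `|phase (logit (push s r)) - phase (logit (push s t))| +
  2 * `|phase (logit r) - phase (logit t)|.
Proof.
have unitB (a b c d : R[i]) : normc a = 1 -> normc b = 1 -> normc c = 1 ->
    normc d = 1 -> normc (a / b - c / d) <= normc (a - c) + normc (b - d).
  move=> a1 b1 c1 d1.
  have unit_neq0 (x : R[i]) : normc x = 1 -> x != 0.
    by move=> x1; apply: contra_eq_neq x1 => ->; rewrite normc0 eq_sym oner_eq0.
  have b0 : b != 0 by exact: unit_neq0.
  have d0 : d != 0 by exact: unit_neq0.
  have -> : a / b - c / d = (a - c) / b + c * ((d - b) / (b * d)).
    by field; rewrite b0 d0.
  rewrite (le_trans (le_normcD _ _))// !normcM !normcV b1 c1 normcM b1 d1.
  by rewrite !mulr1 invr1 !mulr1 mul1r (normc_distC d).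
rewrite (le_trans (unitB _ _ _ _ _ _ _ _)) ?normc_direction//.
by rewrite lerD// normc_cayleyB_le.
Qed.

(** Inside [(0, 1)], [logit_push] writes both phases of [normc_twistB] as continuous functions of
    the radius. *)
Lemma twist_cvg s r : 0 < r < 1 ->
  forall e, 0 < e -> \forall t \near r, normc (twist s r - twist s t) <= e.
Proof.
move=> r01 e e0.
have pc : phase (logit t) @[t --> r] --> phase (logit r).
  by apply: continuous_comp; [exact: logit_continuous|exact: phase_continuous].
have pc' : phase (logit t + s) @[t --> r] --> phase (logit r + s).
  apply: (@continuous_comp _ _ _ (fun t => logit t + s) phase); last first.
    exact: phase_continuous.
  by apply: cvgD; [exact: logit_continuous|exact: cvg_cst].
have e4 : 0 < e / 4 by rewrite divr_gt0.
have /andP[r0 r1] := r01.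
near=> t.
have t01 : 0 < t < 1.
  by apply/andP; split; near: t; [exact: lt_nbhsr|exact: lt_nbhsl].
rewrite (le_trans (normc_twistB _ _ _))// !logit_push//.
have : `|phase (logit r) - phase (logit t)| <= e / 4.
  by near: t; exact: (cvgr_dist_le _ _ pc).
have : `|phase (logit r + s) - phase (logit t + s)| <= e / 4.
  by near: t; exact: (cvgr_dist_le _ _ pc').
lra.
Unshelve. all: by end_near. Qed.

(* Integer times only: [tri] is 1-periodic, so [phase (t + m) - phase t] tends
   to [0]. *)
Lemma twist_cvg1 (m : int) : `|m%:~R| <= 1 :> R ->
  forall e : R, 0 < e ->
    \forall t \near (1 : R), t <= 1 -> normc (1 - twist m%:~R t) <= e.
Proof.
move=> m1 e e0.
(* Since [sqrt M >= 2 / e], the phase bound [1 / sqrt M] is at most [e / 2]; the summand [1] gives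
   [M >= 1], as [phase_shift] requires. *)
pose M : R := 1 + (2 / e) ^+ 2.
(* For [t < 1] this is [M <= logit t], cleared of the logarithm and the denominator. *)
have near_big : \forall t \near (1 : R), expR M * (1 - t) <= t.
  pose g t : R := t - expR M * (1 - t).
  have gc : g t @[t --> (1:R)] --> g 1.
    apply: cvgB; first exact: cvg_id.
    apply: cvgM; first exact: cvg_cst.
    by apply: cvgB; [exact: cvg_cst|exact: cvg_id].
  have : \forall t \near (1 : R), `|g 1 - g t| <= 1.
    exact: (cvgr_dist_le _ _ gc).
  by apply: filterS => t; rewrite /g subrr mulr0 subr0 ler_norml; lra.
near=> t => t1.
have [->|tn1] := eqVneq t 1; first by rewrite twist1 subrr normc0 ltW.
have t01 : 0 < t < 1.
  apply/andP; split; last by rewrite lt_neqAle tn1.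
  by near: t; apply: lt_nbhsr.
have lM : M <= logit t.
  case/andP: t01 => t0 t1'.
  rewrite -(expRK M) ler_ln ?posrE ?expR_gt0 ?divr_gt0 ?subr_gt0//.
  by rewrite ler_pdivlMr ?subr_gt0//; near: t.
have -> : 1 - twist m%:~R t =
    (direction t - direction (push m%:~R t)) / direction t.
  by rewrite mulrBl divff ?direction_neq0.
rewrite normcM normcV normc_direction invr1 mulr1.
rewrite (le_trans (normc_cayleyB_le _ _))// logit_push// distrC.
have M1 : 1 <= M by rewrite lerDl sqr_ge0.
have M0 : 0 < Num.sqrt (logit t) by rewrite sqrtr_gt0; lra.
have := phase_shift (le_trans M1 lM) m1.
suff : (Num.sqrt (logit t))^-1 <= e / 2 by lra.
rewrite -[e / 2]invrK lef_pV2 ?posrE ?invr_gt0 ?divr_gt0// invf_div.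
rewrite -[2 / e]ger0_norm ?divr_ge0 ?(ltW e0)// -sqrtr_sqr ler_wsqrtr//.
by apply: le_trans lM; rewrite /M lerDr.
Unshelve. all: by end_near. Qed.

End Continuity.

(** * Bounds on upper limits of sequences *)

Section LimSup.
Context {R : realType}.
Implicit Types (v : (\bar R)^nat) (e : \bar R).

Lemma limn_esup_ge v e :
  (forall N, exists2 n, (N <= n)%N & (e <= v n)%E) -> (e <= limn_esup v)%E.
Proof.
move=> ev; rewrite /limn_esup limf_esupE.
apply: le_ereal_inf_tmp => _ [V [N _ NV] <-].
have [n Nn evn] := ev N; apply: le_ereal_sup_tmp; exists (v n) => //.
by exists n => //; exact: NV.
Qed.

Lemma limn_esup_le v e N :
  (forall n, (N <= n)%N -> (v n <= e)%E) -> (limn_esup v <= e)%E.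
Proof.
move=> ve; rewrite /limn_esup limf_esupE.
apply: ge_ereal_inf; exists (ereal_sup (v @` [set n | (N <= n)%N])).
  by exists [set n | (N <= n)%N] => //; exists N.
by apply: ge_ereal_sup => _ [n /ve + <-].
Qed.

End LimSup.

(** * The flow on the closed disk and its continuity at integer times *)

Section DiskFlow.
Context {R : realType}.
Implicit Types (z w : disk R) (r s t : R).

Lemma normc_disk z : normc (val z) <= 1.
Proof. by rewrite -lecR; exact: (valP z). Qed.

Lemma disk_flow_subproof s z : `|flow s (val z)| <= 1.
Proof.
rewrite -[leLHS]/(normc _)%:C lecR normc_flow ?normc_disk//.
have : 0 <= normc (val z) <= 1 by rewrite normc_ge0 normc_disk.
by move=> /(push_itv s)/andP[].
Qed.

Definition disk_flow s z : disk R :=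
  Sub (flow s (val z)) (disk_flow_subproof s z).

Lemma mdistE z w : mdist z w = normc (val z - val w). Proof. by []. Qed.

Lemma disk_flow0 z : disk_flow 0 z = z.
Proof. by apply/val_inj; exact: flow0. Qed.

Lemma disk_flowD s t z : disk_flow s (disk_flow t z) = disk_flow (s + t) z.
Proof. by apply/val_inj; apply: flowD; exact: normc_disk. Qed.

Lemma iter_disk_flow s n z : iter n (disk_flow s) z = disk_flow (s *+ n) z.
Proof.
elim: n => [|n IH]; first by rewrite disk_flow0.
by rewrite iterS IH disk_flowD mulrS.
Qed.

Lemma disk_flow_fixed s z : normc (val z) = 1 -> disk_flow s z = z.
Proof. by move=> z1; apply/val_inj; exact: flow1. Qed.

Lemma near_normc z (P : set R) :
  (\forall r \near normc (val z), P r) -> \forall w \near z, P (normc (val w)).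
Proof.
move=> /nbhs_ballP[e /= e0 eP]; apply/nbhs_ballP; exists e => //= w.
rewrite ballEmdist /= mdistE => zw; apply: eP.
rewrite /ball /= (le_lt_trans _ zw)//.
by rewrite ler_norml lerNl opprB normc_sub_ge normc_distC normc_sub_ge.
Qed.

(** The flow multiplies a point by a factor [K] that depends only on the radius. In [a K(a) - b K(b)
    = (a - b) K(b) + a (K(a) - K(b))] the bound on [K] controls the first term; the second vanishes
    at the origin, and elsewhere continuity of [K] controls it. *)
Lemma disk_flow_continuous (m : int) : `|m%:~R| <= 1 :> R ->
  continuous (disk_flow m%:~R).
Proof.
move=> m1 z.
apply/(@metricType_numDomainType.cvgrPdist_le _ _ _ _ (nbhs_filter z)) => e e0.
set s := m%:~R; pose K r : R[i] := (dilation s r)%:C * twist s r.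
have Kle w : normc (K (normc (val w))) <= expR s + 1.
  rewrite /K normcM normc_twist normcR mulr1 ger0_norm.
    by rewrite dilation_le// normc_ge0 normc_disk.
  by rewrite ltW// dilation_gt0// normc_ge0 normc_disk.
have KE w : mdist (disk_flow s z) (disk_flow s w) <=
    (expR s + 1) * mdist z w +
    normc (val z) * normc (K (normc (val z)) - K (normc (val w))).
  rewrite !mdistE [val (disk_flow s z)]/= [val (disk_flow s w)]/= /flow.
  rewrite -!/(K _).
  set a := val z; set b := val w.
  have -> : a * K (normc a) - b * K (normc b) =
    (a - b) * K (normc b) + a * (K (normc a) - K (normc b)) by ring.
  rewrite (le_trans (le_normcD _ _))// lerD//; last by rewrite normcM.
  by rewrite normcM mulrC ler_wpM2r ?normc_ge0 ?Kle.
have near_dist : \forall w \near z, (expR s + 1) * mdist z w <= e / 2.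
  have c0 : 0 < expR s + 1 by rewrite ltr_wpDr ?expR_gt0.
  apply/nbhs_ballP; exists (e / 2 / (expR s + 1)) => /=.
    by rewrite !divr_gt0.
  by move=> w; rewrite ballEmdist /= ltr_pdivlMr// mulrC => /ltW.
suff near_K : \forall w \near z, 
    normc (val z) * normc (K (normc (val z)) - K (normc (val w))) <= e / 2.
  near=> w; rewrite (le_trans (KE w))// [leRHS]splitr lerD//; near: w.
    exact: near_dist.
  exact: near_K.
have [->|z_neq0] := eqVneq (normc (val z)) 0.
  by near=> w; rewrite mul0r divr_ge0 ?ltW.
have z0 : 0 < normc (val z) by rewrite lt_neqAle eq_sym z_neq0 normc_ge0.
have e4 : 0 < e / 4 by rewrite divr_gt0.
(* The guard [r <= 1] matches the one-sided limit of [twist_cvg1] at the circle. *)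
suff : \forall r \near normc (val z), r <= 1 ->
    normc (K (normc (val z)) - K r) <= e / 2.
  move=> /near_normc; apply: filterS => w /(_ (normc_disk w)) Kw.
  by rewrite (le_trans _ Kw)// ler_piMl ?normc_ge0 ?normc_disk.
move: (normc_disk z) z0; set r0 := normc (val z) => r01 r00.
have r0_itv : 0 <= r0 <= 1 by rewrite ltW.
have near_dil : \forall r \near r0, `|dilation s r0 - dilation s r| <= e / 4.
  have dc : dilation s r @[r --> r0] --> dilation s r0.
    exact: dilation_continuous.
  exact: (cvgr_dist_le _ _ dc).
have d0 : 0 < dilation s r0 by rewrite dilation_gt0.
have near_twist : \forall r \near r0, r <= 1 ->
    normc (twist s r0 - twist s r) <= e / 4 / dilation s r0.
  have ed0 : 0 < e / 4 / dilation s r0 by rewrite divr_gt0.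
  (* On the circle the integrality of [m] enters, through [twist_cvg1]; the interior case is
     [twist_cvg]. *)
  move: r01; rewrite le_eqVlt => /predU1P[->|r0_lt1].
    by rewrite twist1 dilation1 divr1; exact: (twist_cvg1 m1 e4).
  have := @twist_cvg _ s r0 _ _ ed0; rewrite r00 r0_lt1 => /(_ isT).
  by apply: filterS.
near=> r => r1.
have -> : K r0 - K r = (dilation s r0)%:C * (twist s r0 - twist s r) +
    (dilation s r0 - dilation s r)%:C * twist s r.
  by rewrite rmorphB /=  /K; ring.
rewrite (le_trans (le_normcD _ _))// normcM normcR.
rewrite [X in _ + X]normcM normcR normc_twist mulr1.
rewrite (gtr0_norm d0).
have : `|dilation s r0 - dilation s r| <= e / 4 by near: r.
have : normc (twist s r0 - twist s r) <= e / 4 / dilation s r0.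
  by move: r1; near: r.
rewrite ler_pdivlMr// mulrC; lra.
Unshelve. all: by end_near. Qed.

End DiskFlow.

(** * Backward time: absence of Li-Yorke pairs *)

Section Backward.
Context {R : realType}.
Implicit Types (x y : disk R) (r e : R).

(** Here [push (- n) r <= expR (- n) / (1 - r)], and [expR n >= n], so any [n] above
    [1 / (e (1 - r))] works. *)
Lemma push_backward r e : 0 <= r < 1 -> 0 < e ->
  exists N, forall n, (N <= n)%N -> push (- n%:R) r <= e.
Proof.
move=> /andP[r0 r1] e0; have r1' : 0 < 1 - r by rewrite subr_gt0.
have r01 : 0 <= r <= 1 by rewrite r0 ltW.
exists (Num.truncn ((e * (1 - r))^-1)).+1 => n Nn.
have nle : (e * (1 - r))^-1 <= n%:R.
  rewrite (le_trans (ltW (truncnS_gt _)))// ler_nat//.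
have En : (e * (1 - r))^-1 <= expR n%:R.
  by rewrite (le_trans nle)// (le_trans _ (expR_ge1Dx _))// lerDr.
have E0 : expR (- n%:R) <= e * (1 - r).
  by rewrite expRN -[leRHS]invrK lef_pV2 ?posrE ?invr_gt0 ?mulr_gt0 ?expR_gt0.
rewrite /push /dilation mulrAC ler_pdivrMr ?dilation_den_gt0//.
have := mulr_ge0 (ltW (expR_gt0 (- n%:R))) r0.
have := expR_gt0 (- n%:R : R); set c := expR _ in E0 *; nra.
Qed.

Lemma normc_disk_flow s x :
  normc (val (disk_flow s x)) = push s (normc (val x)).
Proof. by apply: normc_flow; exact: normc_disk. Qed.

Lemma orbit_dist_disk_flow s x y n :
  orbit_dist (disk_flow s) x y n =
  (normc (val (disk_flow (s *+ n) x) - val (disk_flow (s *+ n) y)))%:E.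
Proof. by rewrite /orbit_dist !iter_disk_flow. Qed.

Lemma li_yorke_pairC (f : disk R -> disk R) x y :
  li_yorke_pair f x y -> li_yorke_pair f y x.
Proof.
rewrite /li_yorke_pair (_ : orbit_dist f y x = orbit_dist f x y)//.
by apply/funext => n; rewrite /orbit_dist !mdistE normc_distC.
Qed.

Lemma limn_einf_ge (u : (\bar R)^nat) (c : \bar R) N :
  (forall n, (N <= n)%N -> (c <= u n)%E) -> (c <= limn_einf u)%E.
Proof.
move=> cu; rewrite /limn_einf leeNr; apply: (@limn_esup_le _ _ _ N) => n Nn.
by rewrite leeN2 cu.
Qed.

(** Two points of the circle keep a constant positive distance, and an interior point ends up at
    least [1/2] away from a point of the circle: both contradict the lower limit [0]. Two interior
    points both tend to [0], which contradicts the positive upper limit. *)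
Lemma no_li_yorke_pair_backward x y : x <> y ->
  ~ li_yorke_pair (disk_flow (-1)) x y.
Proof.
move=> xy.
have normE (z : disk R) n :
    normc (val (disk_flow (-1 *+ n) z)) = push (- n%:R) (normc (val z)).
  by rewrite normc_disk_flow mulNrn.
have mixed (z w : disk R) : normc (val z) < 1 -> normc (val w) = 1 ->
    ~ li_yorke_pair (disk_flow (-1)) z w.
  move=> z1 w1 [_ inf0].
  have [||N Nle] := @push_backward (normc (val z)) (1 / 2); rewrite ?normc_ge0//.
  have : ((1 / 2)%:E <= limn_einf (orbit_dist (disk_flow (-1)) z w))%E.
    apply: (@limn_einf_ge _ _ N) => n /Nle zn.
    rewrite orbit_dist_disk_flow lee_fin normc_distC.
    rewrite (le_trans _ (normc_sub_ge _ _))//.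
    by rewrite !normE w1 push1; lra.
  by rewrite inf0 lee_fin; lra.
have [x1|x1] := ltP (normc (val x)) 1; last first.
  have {}x1 : normc (val x) = 1 by apply/eqP; rewrite eq_le x1 normc_disk.
  have [y1|y1] := ltP (normc (val y)) 1.
    by move=> /li_yorke_pairC; exact: mixed.
  have {}y1 : normc (val y) = 1 by apply/eqP; rewrite eq_le y1 normc_disk.
  move=> [_ inf0]; have : 0 < mdist x y by rewrite mdist_gt0; apply/eqP.
  suff : ((mdist x y)%:E <= limn_einf (orbit_dist (disk_flow (-1)) x y))%E.
    by rewrite inf0 lee_fin leNgt => /negPf->.
  apply: (@limn_einf_ge _ _ 0) => n _.
  by rewrite orbit_dist_disk_flow !disk_flow_fixed.
have [y1|y1] := ltP (normc (val y)) 1; last first.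
  by apply: mixed => //; apply/eqP; rewrite eq_le y1 normc_disk.
move=> [+ _]; rewrite ltNge => /negP; apply.
apply/lee_addgt0Pr => e e0; rewrite add0e.
have e2 : 0 < e / 2 by rewrite divr_gt0.
have [||N xN] := @push_backward (normc (val x)) (e / 2); rewrite ?normc_ge0//.
have [||M yM] := @push_backward (normc (val y)) (e / 2); rewrite ?normc_ge0//.
apply: (@limn_esup_le _ _ _ (maxn N M)) => n.
rewrite geq_max => /andP[/xN xn /yM yn].
rewrite orbit_dist_disk_flow lee_fin (le_trans (le_normcD _ _))// normcN !normE.
by rewrite [leRHS]splitr lerD.
Qed.

(** A set whose distinct points all form Li-Yorke pairs has at most one point. *)
Lemma not_li_yorke_chaotic_backward :
  ~ li_yorke_chaotic (disk_flow (-1) : disk R -> disk R).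
Proof.
move=> [G [Gunc GLY]]; apply: Gunc.
have [[x Gx]|G0] := pselect (exists x, G x); last first.
  rewrite (_ : G = set0); first exact: countable0.
  by apply/seteqP; split => // x Gx; apply: G0; exists x.
rewrite (_ : G = [set x]); first exact: countable1.
apply/seteqP; split => [y Gy|y ->//]; apply: contrapT => yx.
by apply: (no_li_yorke_pair_backward yx); exact: GLY.
Qed.

End Backward.

(** * Forward time: an uncountable scrambled set *)

Section Forward.
Context {R : realType}.
Implicit Types (s t r e : R).

Lemma logit_half : logit (1 / 2 : R) = 0.
Proof. by rewrite /logit (_ : 1 / 2 / (1 - 1 / 2) = 1) ?ln1//; field. Qed.

Lemma half_in_disk : `| (1 / 2 : R)%:C * direction (1 / 2 : R) | <= 1.
Proof.
rewrite -[leLHS]/(normc _)%:C lecR normcM normc_direction normcR mulr1.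
by rewrite ger0_norm; lra.
Qed.

(** Keeping the factor [direction (1 / 2)] lets it cancel the denominator of [twist] in
    [val_flow_base], so that the phase at time [t] is exactly [phase t]. *)
Definition base_point : disk R :=
  Sub ((1 / 2)%:C * direction (1 / 2)) half_in_disk.

Lemma val_flow_base t : val (disk_flow t base_point) =
  (push t (1 / 2))%:C * cayley (phase t).
Proof.
have normb : normc (val base_point) = 1 / 2.
  by rewrite [val _]/= normcM normc_direction normcR mulr1 ger0_norm; lra.
rewrite [LHS]/= /flow -[(1/2)%:C * direction _]/(val base_point) normb.
have -> : twist t (1 / 2 : R) = cayley (phase t) / direction (1 / 2).
  rewrite /twist {1}/direction logit_push; last by lra.
  by rewrite logit_half add0r.
rewrite /push [(_ * (1 / 2))%:C]rmorphM [val _]/=.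
have := direction_neq0 (1 / 2 : R).
set a := direction _ => a0; set b := cayley _; set c := (dilation _ _)%:C.
by field.
Qed.

(** The gap [1 - push t (1 / 2)] equals [1 / (1 + expR t)], and [expR t >= 1 + t]. *)
Lemma push_half_dist t : 0 < t -> 1 - t^-1 <= push t (1 / 2) <= 1.
Proof.
move=> t0; have h : 0 <= (1 / 2 : R) <= 1 by lra.
have /andP[_ ->] := push_itv t h; rewrite andbT lerBlDr -lerBlDl onem_push//.
have := expR_ge1Dx t; set c := expR t => ct.
by rewrite ler_pdivrMr; [rewrite ler_pdivlMl//; lra|lra].
Qed.

(** Adding the integer [j ^ 2] keeps the factor [tri] equal to [t], and within time [1/2] of [j ^ 2]
    the factor [slow] varies by at most [1 / j]. *)
Lemma phase_add_sqr t j : 0 <= t <= 1 / 2 -> (0 < j)%N ->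
  `|phase (t + (j ^ 2)%:R) - t * slow (j ^ 2)%:R| <= j%:R^-1.
Proof.
move=> t01 j0; have j1 : 1 <= (j ^ 2)%:R :> R by rewrite ler1n expn_gt0 j0.
rewrite /phase (triDz t (Posz (j ^ 2))) tri_id// -mulrBr normrM.
rewrite ger0_norm; last by lra.
have t1 : `|(j ^ 2)%:R - (t + (j ^ 2)%:R)| <= 1.
  by rewrite opprD addrCA subrr addr0 normrN ger0_norm; lra.
have := slow_close j1 t1.
have -> : Num.sqrt (j ^ 2)%:R = j%:R :> R by rewrite natrX sqrtr_sqr ger0_norm.
rewrite distrC.
have := normr_ge0 (slow (t + (j ^ 2)%:R) - slow (j ^ 2)%:R); nra.
Qed.

(** At these times both radii are within [1 / j] of [1], and the phases within [1 / j] of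
    [s * slow (j ^ 2)] and [t * slow (j ^ 2)]. Phase and radial errors of [2 / j] each give the
    [4 / j] below; above, the Lipschitz constant [2] of [cayley] doubles the phase part, giving
    [6 / j]. *)
Lemma normc_flow_base_sub s t j : 0 <= s <= 1 / 2 -> 0 <= t <= 1 / 2 ->
  (0 < j)%N ->
  `|s - t| * slow (j ^ 2)%:R - 4 / j%:R <=
  normc (val (disk_flow (s + (j ^ 2)%:R) base_point) -
         val (disk_flow (t + (j ^ 2)%:R) base_point)) <=
  2 * `|s - t| * slow (j ^ 2)%:R + 6 / j%:R.
Proof.
move=> s01 t01 j0.
have j1 : 1 <= j%:R :> R by rewrite ler1n.
have jj : (j%:R : R) <= (j ^ 2)%:R by rewrite ler_nat; nia.
have j_inv : 0 < j%:R^-1 :> R by rewrite invr_gt0; lra.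
have rad (c : R) : 0 <= c <= 1 / 2 ->
    1 - j%:R^-1 <= push (c + (j ^ 2)%:R) (1 / 2) <= 1.
  move=> c01; have c0 : 0 < c + (j ^ 2)%:R by lra.
  have /andP[h ->] := push_half_dist c0; rewrite andbT (le_trans _ h)//.
  by rewrite lerB// lef_pV2 ?posrE//; lra.
have /andP[pa pa1] := rad s s01; have /andP[pb pb1] := rad t t01.
have := phase_add_sqr s01 j0; have := phase_add_sqr t01 j0.
rewrite !val_flow_base.
set p := push (s + _) _ in pa pa1 *; set q := push (t + _) _ in pb pb1 *.
set x := phase (s + _); set y := phase (t + _); set w := slow _ => yw xw.
pose d := normc (cayley x - cayley y).
have xy_lo : `|s - t| * w - 2 * j%:R^-1 <= `|x - y|.
  have -> : `|s - t| * w = `|(x - y) - (x - s * w) + (y - t * w)|.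
    rewrite -[w in LHS]ger0_norm ?slow_ge0// -normrM; congr Num.norm; ring.
  have := ler_normD ((x - y) - (x - s * w)) (y - t * w).
  have := ler_normB (x - y) (x - s * w); lra.
have xy_hi : `|x - y| <= `|s - t| * w + 2 * j%:R^-1.
  have -> : x - y = (s - t) * w + (x - s * w) - (y - t * w) by ring.
  have := ler_normB ((s - t) * w + (x - s * w)) (y - t * w).
  have := ler_normD ((s - t) * w) (x - s * w).
  rewrite normrM [`|w|]ger0_norm ?slow_ge0//; lra.
have d_lo : `|x - y| <= d by rewrite normc_cayleyB_ge ?phase_norm_le1.
have d_hi : d <= 2 * `|x - y| by rewrite normc_cayleyB_le.
(* The correction for moving both points radially onto the circle. *)
pose u : R[i] := (1 - p)%:C * cayley x - (1 - q)%:C * cayley y.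
have u_le : normc u <= 2 * j%:R^-1.
  have scaleE (r c : R) : r <= 1 -> normc ((1 - r)%:C * cayley c) = 1 - r.
    by move=> r1; rewrite normcM normcR normc_cayley mulr1 ger0_norm ?subr_ge0.
  rewrite (le_trans (le_normcD _ _))// normcN !scaleE//; lra.
set z := p%:C * cayley x - q%:C * cayley y.
have zE : z = cayley x - cayley y - u.
  by rewrite /z /u !rmorphB !rmorph1; ring.
have z_hi : normc z <= d + normc u.
  by rewrite zE (le_trans (le_normcD _ _))// normcN.
have z_lo : d - normc u <= normc z by rewrite zE normc_sub_ge.
by rewrite mulrC -/w; apply/andP; split; lra.
Qed.

(** At odd squares [slow] is [1/2] and the points are apart; at even squares it is [0] and they come
    together. *)
Lemma forward_pair s t : 0 <= s <= 1 / 2 -> 0 <= t <= 1 / 2 -> s != t ->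
  li_yorke_pair (disk_flow 1) (disk_flow s base_point) (disk_flow t base_point).
Proof.
move=> s01 t01 st.
have orbitE n :
    orbit_dist (disk_flow 1) (disk_flow s base_point) (disk_flow t base_point) n =
    (normc (val (disk_flow (s + n%:R) base_point) -
            val (disk_flow (t + n%:R) base_point)))%:E.
  by rewrite orbit_dist_disk_flow !disk_flowD ![1 *+ n + _]addrC.
have far (e : R) N : 0 < e -> exists2 k, (N <= k)%N & 6 / k.+1%:R <= e.
  move=> e0; exists (N + Num.truncn (6 / e))%N; first exact: leq_addr.
  rewrite ler_pdivrMr ?ltr0n// mulrC -ler_pdivrMr//.
  rewrite (le_trans (ltW (truncnS_gt _)))//.
  by rewrite ler_nat ltnS leq_addl.
split.
(* At odd squares the main term is [|s - t| / 2]; half of it absorbs the error. *)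
- have st0 : 0 < `|s - t| / 4 by rewrite divr_gt0// normr_gt0 subr_eq0.
  apply: (@lt_le_trans _ _ (`|s - t| / 4)%:E); first by rewrite lte_fin.
  apply: limn_esup_ge => N; have [k Nk ke] := far _ N st0.
  exists ((2 * k).+1 ^ 2)%N; first by nia.
  rewrite orbitE lee_fin.
  have /andP[+ _] := @normc_flow_base_sub s t (2 * k).+1 s01 t01 isT.
  apply: le_trans; rewrite slow_odd.
  have : 4 / (2 * k).+1%:R <= 6 / k.+1%:R :> R.
    rewrite ler_pdivrMr ?ltr0n// mulrAC ler_pdivlMr ?ltr0n//.
    by rewrite -!natrM ler_nat; nia.
  move=> /le_trans/(_ ke); set q := 4 / _; lra.
- apply/eqP; rewrite eq_le; apply/andP; split; last first.
    by apply: (@limn_einf_ge _ _ _ 0) => n _; rewrite orbitE lee_fin normc_ge0.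
  apply/lee_addgt0Pr => e e0; rewrite add0e leeNl.
  apply: limn_esup_ge => N; have [k Nk ke] := far _ N e0.
  (* Using [k.+1] instead of [k] keeps the base of the square positive. *)
  exists ((2 * k.+1) ^ 2)%N; first by nia.
  rewrite leeN2 orbitE lee_fin.
  have /andP[_] := @normc_flow_base_sub s t (2 * k.+1) s01 t01 isT.
  rewrite slow_even mulr0 add0r => /le_trans; apply; apply: le_trans ke.
  by rewrite ler_pM2l// lef_pV2 ?posrE ?ltr0n// ler_nat; lia.
Qed.

Lemma li_yorke_chaotic_forward :
  li_yorke_chaotic (disk_flow 1 : disk R -> disk R).
Proof.
exists ((fun t => disk_flow t base_point) @` `[0, (1 / 2)%R]); split; last first.
  move=> _ _ [s /= s01 <-] [t /= t01 <-] st.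
  rewrite !in_itv /= in s01 t01; apply: forward_pair => //.
  by apply: contra_not_neq st => ->.
move=> cG.
(* [height] recovers the time [t] from the point, so countably many points would make [[0, 1/2]]
   countable, against its positive Lebesgue measure. *)
pose height (x : disk R) : R := logit (normc (val x)).
have heightK (t : R) : height (disk_flow t base_point) = t.
  rewrite /height val_flow_base normcM normc_cayley mulr1 normcR.
  rewrite ger0_norm; last first.
    by have /(push_itv t)/andP[] : 0 <= (1 / 2 : R) <= 1 by lra.
  rewrite logit_push; last by lra.
  by rewrite logit_half add0r.
have : countable (height @`
    ((fun t => disk_flow t base_point) @` `[0, (1 / 2)%R])).
  exact: (sub_countable (card_image_le _ _)).
rewrite image_comp (_ : _ @` _ = `[0, (1 / 2)%R]%classic); last first.
  apply/seteqP; split => [_ [t ? <-]|t ?] /=; first by rewrite heightK.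
  by exists t; rewrite //= heightK.
move=> /countable_lebesgue_measure0.
rewrite lebesgue_measure_itv /= lte_fin ifT; last by lra.
by move=> /eqP; rewrite -EFinD eqe => /eqP; lra.
Qed.

End Forward.

Theorem theorem2p3 (R : realType) :
  exists f g : disk R -> disk R,
    [/\ continuous f, continuous g, cancel f g & cancel g f] /\
    li_yorke_chaotic f /\ ~ li_yorke_chaotic g.
Proof.
exists (disk_flow 1), (disk_flow (-1)); split; last first.
  split; first exact: li_yorke_chaotic_forward.
  exact: not_li_yorke_chaotic_backward.
split.
(* The times [1] and [-1] are read as integers, the case in which the flow is known to be continuous
   up to the circle. *)
- by apply: (@disk_flow_continuous _ 1); rewrite normr1.
- by apply: (@disk_flow_continuous _ (-1)); rewrite mulrN1z normrN normr1.
- by move=> z; rewrite disk_flowD addNr disk_flow0.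
- by move=> z; rewrite disk_flowD subrr disk_flow0.
Qed.
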